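(* Let $f(x),g(x)\in\mathbb{Z}[x]$ be non-zero polynomials, let $d(x)$ be their greatest common divisor in $\mathbb{Z}[x]$, let $R=\mathrm{res}\big(f(x)/d(x),g(x)/d(x)\big)$, and let $w$ be the gcd of the leading coefficients of $f$ and $g$. If $p$ is a prime with $p>2\cdot A_{f,g}$, then $p\nmid R$ (whatever the greatest common divisor $d(x)$ is) and $p\nmid w$. Consequently the Big prime modular gcd algorithm described in the context, when it uses this $p$ as its prime, outputs the correct greatest common divisor of $f(x)$ and $g(x)$ using just this one prime: the divisibility test succeeds and no other prime has to be taken.
   Context: $\mathrm{res}$ denotes the resultant (determinant of the Sylvester matrix). For a non-zero polynomial $u(x)=u_0x^n+\cdots+u_n\in\mathbb{Z}[x]$ with $u_0\neq0$: $\mathrm{lc}(u)=u_0$; $\|u\|=\sqrt{\sum_{i=0}^n u_i^2}$; $\mathrm{cont}(u)$ is the gcd of the coefficients, with sign chosen equal to the sign of $\mathrm{lc}(u)$; $\mathrm{pp}(u)=u/\mathrm{cont}(u)$. Greatest common divisors in $\mathbb{Z}[x]$ are defined up to sign. For $f,g$ of degrees $n,m$, $$A_{f,g}=2^{2nm-n-m}\sqrt{(n+1)^m(m+1)^n}\cdot\|f\|^m\|g\|^n .$$ Big prime modular gcd algorithm on input $f,g$: set $r=\gcd(\mathrm{cont}(f),\mathrm{cont}(g))$; let $F=\mathrm{pp}(f)$, $G=\mathrm{pp}(g)$, let $w'>0$ be the gcd of $\mathrm{lc}(F)$ and $\mathrm{lc}(G)$, and set $D=\min\{\deg F,\deg G\}+1$.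 Then: (a) choose a new prime $p$ and compute, by the Euclidean algorithm, a gcd $e_p(x)$ in $\mathbb{Z}_p[x]$ of the coefficientwise reductions of $F$ and $G$ modulo $p$, where $\mathbb{Z}_p=\{0,\dots,p-1\}$ is the field of residues; (b) if $\deg e_p(x)\ge D$, go back to (a); (c) otherwise choose $t\in\mathbb{Z}_p$ with $\mathrm{lc}(t\cdot e_p(x))=w'$ in $\mathbb{Z}_p$, let $k(x)\in\mathbb{Z}[x]$ be obtained from $t\cdot e_p(x)$ by replacing each coefficient $b\in\{0,\dots,p-1\}$ by $b$ if $b<p/2$ and by $b-p$ otherwise; (d) if $\mathrm{pp}(k(x))$ divides both $F$ and $G$ (the divisibility test), output $r\cdot\mathrm{pp}(k(x))$ and stop; otherwise set $D=\deg e_p(x)$ and go back to (a).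
   Formalization: The claim that p does not divide w is proved only when f and g are not both constant; for two constants it is false (f = g = 3, p = 3: A = 1, so p > 2A, yet w = 3). *)

(* Defs.v *)
From mathcomp Require Import all_boot all_order all_algebra.

Set Implicit Arguments.
Unset Strict Implicit.
Unset Printing Implicit Defensive.

Import Order.TTheory GRing.Theory Num.Theory.

Local Open Scope ring_scope.

Definition deg (S : nzSemiRingType) (u : {poly S}) : nat := (size u).-1.

(* Divisibility in Z[x]; the library's %| on {poly int} is pseudo-divisibility,
   which ignores constant factors, and so is not used here. *)
Definition zdvdp (d u : {poly int}) : Prop := exists q, u = q * d.

(* d is one of the two greatest common divisors of f and g in Z[x]. *)
Definition is_zgcdp (d f g : {poly int}) : Prop :=
  [/\ zdvdp d f, zdvdp d g & forall c, zdvdp c f -> zdvdp c g -> zdvdp c d].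

Definition norm2 (R : rcfType) (u : {poly int}) : R :=
  Num.sqrt (\sum_(i < size u) (u`_i)%:~R ^+ 2).

(* The exponent of 2 is an integer: it is negative when exactly one of f and g
   is constant. *)
Definition Abound (R : rcfType) (f g : {poly int}) : R :=
  let n := deg f in let m := deg g in
  (2 : R) ^ (2 * n%:Z * m%:Z - n%:Z - m%:Z)
    * Num.sqrt ((n.+1 ^ m * m.+1 ^ n)%N%:R) * norm2 R f ^+ m * norm2 R g ^+ n.

Definition redp (p : nat) (u : {poly int}) : {poly 'F_p} := map_poly intr u.

Definition centered (p : nat) (b : 'F_p) : int :=
  if (2 * b < p)%N then b%:Z else b%:Z - p%:Z.

Definition centered_lift (p : nat) (u : {poly 'F_p}) : {poly int} :=
  map_poly (@centered p) u.

(* [zcontents] and [zprimitive] are cont and pp; [gcdz] is nonnegative. *)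
Definition gcd_cont (f g : {poly int}) : int := gcdz (zcontents f) (zcontents g).

Definition gcd_lc (f g : {poly int}) : int := gcdz (lead_coef f) (lead_coef g).

(* e is a possible e_p(x): any gcd of the two reductions, since the one returned
   by the Euclidean algorithm is only normalized up to a unit of Z_p. *)
Definition is_modular_gcd (p : nat) (F G : {poly int}) (e : {poly 'F_p}) : Prop :=
  e %= gcdp (redp p F) (redp p G).

(* k is a possible k(x) obtained from the modular gcd e. *)
Definition is_candidate (p : nat) (F G : {poly int}) (e : {poly 'F_p})
    (k : {poly int}) : Prop :=
  exists2 t : 'F_p, lead_coef (t *: e) = (gcd_lc F G)%:~R
                  & k = centered_lift (t *: e).

Definition div_test (F G k : {poly int}) : Prop :=
  zdvdp (zprimitive k) F /\ zdvdp (zprimitive k) G.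

(* [Running ps D]: about to choose a new prime, the primes ps having been taken
   already (latest first). [Halted ps h]: h was output after taking ps. *)
Inductive bpm_state : Type :=
| Running of seq nat & nat
| Halted of seq nat & {poly int}.

Definition bpm_start (f g : {poly int}) : bpm_state :=
  Running [::] (minn (deg (zprimitive f)) (deg (zprimitive g))).+1.

(* [bpm_step f g s p s']: in state s, the algorithm on input f, g may choose the
   prime p, and one pass with this prime leads to state s'. *)
Inductive bpm_step (f g : {poly int}) : bpm_state -> nat -> bpm_state -> Prop :=
| BpmDegree (ps : seq nat) (D p : nat) (e : {poly 'F_p}) :
    prime p -> p \notin ps ->
    is_modular_gcd (zprimitive f) (zprimitive g) e ->
    (D <= deg e)%N ->
    bpm_step f g (Running ps D) p (Running (p :: ps) D)
| BpmOutput (ps : seq nat) (D p : nat) (e : {poly 'F_p}) (k : {poly int}) :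
    prime p -> p \notin ps ->
    is_modular_gcd (zprimitive f) (zprimitive g) e ->
    (deg e < D)%N ->
    is_candidate (zprimitive f) (zprimitive g) e k ->
    div_test (zprimitive f) (zprimitive g) k ->
    bpm_step f g (Running ps D) p
      (Halted (p :: ps) (gcd_cont f g *: zprimitive k))
| BpmRetry (ps : seq nat) (D p : nat) (e : {poly 'F_p}) (k : {poly int}) :
    prime p -> p \notin ps ->
    is_modular_gcd (zprimitive f) (zprimitive g) e ->
    (deg e < D)%N ->
    is_candidate (zprimitive f) (zprimitive g) e k ->
    ~ div_test (zprimitive f) (zprimitive g) k ->
    bpm_step f g (Running ps D) p (Running (p :: ps) (deg e)).

(* Main.v *)
Require Import Defs.
From mathcomp Require Import all_boot all_order all_algebra.
From mathcomp Require Import fingroup perm algC zify ring.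

Set Implicit Arguments.
Unset Strict Implicit.
Unset Printing Implicit Defensive.

Import Order.TTheory GRing.Theory Num.Theory.

Local Open Scope ring_scope.

(** Write f = f1 * d and g = g1 * d with f1, g1 coprime, so that res(f1, g1) is a
non-zero integer.  An integer that is non-zero and smaller than p in absolute
value is not divisible by p, so the first two claims are upper bounds.  With
n = deg f and m = deg g, they rest on Mignotte's inequality ([mignotte_int]): a
factor u of v has 1-norm at most 2 ^ deg u times the Euclidean norm of v.  It
follows from Landau's inequality between the Mahler measure and the Euclidean
norm ([landau]), applied to the roots among the complex algebraic numbers.

- The Leibniz formula bounds the resultant of f1 and g1 by the product of the
  1-norms of the rows of the Sylvester matrix ([resultant_le]).  If d is
  constant, Cauchy-Schwarz turns these norms into Euclidean norms and yields the
  factor sqrt ((n+1)^m (m+1)^n); if not, Mignotte's inequality costs only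
  4 ^ ((n-1) (m-1)), which is at most 2 ^ (2nm-n-m) ([resultant_sqr_le]).
- The leading coefficients are bounded by the Euclidean norms.

When f or g is constant the exponent of 2 may be negative and the resultant may
exceed p; it is then a power of a constant, which is smaller than p unless the
exponent is 0 ([large_gt_constant]).

For the algorithm, let F, G be the primitive parts and d their primitive gcd.
If the two cofactors are non-constant, their resultant lies in the ideal that
they generate, so their primitive parts stay coprime modulo p
([coprimep_redp]), and the modular gcd is the reduction of d up to a unit.
Normalizing its leading coefficient to w', the gcd of lc F and lc G, gives the
reduction of H = (w' / lc d) d, a polynomial over the integers because lc d
divides w'.  If d is non-constant, the coefficients of H are smaller than p / 2 by
Mignotte's inequality ([candidate_sqr_le]), so the centered lift is H; if d = 1,
the lift is a non-zero constant.  In both cases its primitive part is d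
([candidate_primitive]).

When both degrees are positive, the bounds are compared after squaring, as
inequalities between natural numbers. *)

(** * Landau's and Mignotte's inequalities over an algebraically closed field *)

Section PowerSums.
Variable C : numClosedFieldType.
Implicit Types (u h : {poly C}) (z : C) (r : seq C).

Definition psum k u : C := \sum_(i < size u) `|u`_i| ^+ k.

Lemma psumE k n u : (0 < k)%N -> (size u <= n)%N ->
  psum k u = \sum_(i < n) `|u`_i| ^+ k.
Proof.
move=> k_gt0 le_un; rewrite /psum (big_ord_widen n (fun i => `|u`_i| ^+ k)) //.
rewrite big_mkcond; apply: eq_bigr => i _; case: ltnP => // le_ui.
by rewrite nth_default // normr0 expr0n gtn_eqF.
Qed.

Lemma psumS k n u : (0 < k)%N -> (size u <= n)%N ->
  psum k u = \sum_(i < n.+1) `|(u * 'X)`_i| ^+ k.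
Proof.
move=> k_gt0 le_un; rewrite big_ord_recl coefMX /= normr0 expr0n gtn_eqF // add0r.
by rewrite (psumE k_gt0 le_un); apply: eq_bigr => i _; rewrite coefMX.
Qed.

Lemma size_lin_mul (a b : C) h : (size ((a *: 'X + b%:P) * h)%R <= (size h).+1)%N.
Proof.
apply: leq_trans (size_polyMleq _ _) _.
have : (size (a *: 'X + b%:P)%R <= 2)%N.
  apply: leq_trans (size_polyD _ _) _; rewrite geq_max size_polyC.
  rewrite (leq_trans (size_scale_leq _ _)) ?size_polyX //=; by case: (b != 0).
by move=> ?; lia.
Qed.

(** Reflecting a root in the unit circle preserves the Euclidean norm: the squared
moduli of the coefficients differ by a telescoping sum. *)
Lemma psum2_reflect_root z h :
  psum 2 (('X - z%:P) * h) = psum 2 ((z^* *: 'X - 1) * h).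
Proof.
have s1 : (size (('X - z%:P) * h)%R <= (size h).+1)%N.
  by have := size_lin_mul 1 (- z) h; rewrite scale1r polyCN.
have s2 : (size ((z^* *: 'X - 1) * h)%R <= (size h).+1)%N.
  by have := size_lin_mul z^* (- 1) h; rewrite polyCN.
rewrite (psumE _ s1) // (psumE _ s2) //; apply/eqP; rewrite -subr_eq0 -sumrB.
have E i : `|(('X - z%:P) * h)`_i| ^+ 2 - `|((z^* *: 'X - 1) * h)`_i| ^+ 2
   = (1 - `|z| ^+ 2) * (`|(h * 'X)`_i| ^+ 2 - `|h`_i| ^+ 2).
  rewrite !mulrBl mul1r -scalerAl mul_polyC !coefB !coefZ (mulrC 'X).
  set a := (h * 'X)`_i; set b := h`_i.
  rewrite !normCK !rmorphB !rmorphM /= conjCK.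
  ring.
under eq_bigr do rewrite E.
by rewrite -mulr_sumr sumrB -(psumS _ (leqnn _)) // -(@psumE 2) ?leqnSn // subrr mulr0.
Qed.

(** The factor that a root z contributes to the Mahler measure. *)
Definition radius z : C := if 1 < `|z| then `|z| else 1.

Lemma radius_ge1 z : 1 <= radius z.
Proof. by rewrite /radius; case: ifP => // /ltW. Qed.

Lemma radius_ge_norm z : `|z| <= radius z.
Proof.
by rewrite /radius; case: ifP => // /negbT; rewrite -real_leNgt ?normr_real.
Qed.

Lemma prod_radius_ge1 r : 1 <= \prod_(z <- r) radius z.
Proof.
elim: r => [|z r IH]; first by rewrite big_nil.
by rewrite big_cons mulr_ege1 ?radius_ge1.
Qed.

Lemma psum2_ge_lead h : `|lead_coef h| ^+ 2 <= psum 2 h.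
Proof.
have [->|nz] := eqVneq h 0.
  by rewrite lead_coef0 normr0 expr0n /psum size_poly0 big_ord0.
rewrite /psum polySpred //= big_ord_recr /= lead_coefE.
by rewrite lerDr sumr_ge0 // => i _; rewrite exprn_ge0.
Qed.

(** Landau's inequality, where h is a cofactor that makes the induction work: a
root outside the unit circle is first reflected, which keeps the norm and
multiplies the leading coefficient by the conjugate of the root; the resulting
linear factor is then absorbed into h. *)
Lemma landau r h :
  (`|lead_coef h| * \prod_(z <- r) radius z) ^+ 2
    <= psum 2 (h * \prod_(z <- r) ('X - z%:P)).
Proof.
elim: r h => [|z r IH] h.
  by rewrite !big_nil !mulr1 psum2_ge_lead.
rewrite !big_cons [h * _]mulrCA; have [gt1|le1] := boolP (1 < `|z|).
  have -> : radius z = `|z| by rewrite /radius gt1.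
  rewrite psum2_reflect_root mulrCA [_ * (h * _)]mulrA mulrA.
  apply: le_trans (IH ((z^* *: 'X - 1) * h)).
  have nz : z^* != 0 by rewrite conjC_eq0 -normr_gt0 (lt_trans ltr01).
  rewrite lead_coefM lead_coefDl ?lead_coefZ ?lead_coefX ?mulr1; last first.
    by rewrite size_polyN size_poly1 size_scale ?size_polyX.
  by rewrite normrM norm_conjC lexx.
have -> : radius z = 1 by rewrite /radius (negPf le1).
rewrite mul1r mulrA; apply: le_trans (IH (('X - z%:P) * h)).
by rewrite lead_coefM lead_coefXsubC mul1r.
Qed.

Lemma psum1_XsubC z h : psum 1 (('X - z%:P) * h) <= (1 + `|z|) * psum 1 h.
Proof.
have s1 : (size (('X - z%:P) * h)%R <= (size h).+1)%N.
  by have := size_lin_mul 1 (- z) h; rewrite scale1r polyCN.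
rewrite (psumE _ s1) // [leRHS]mulrDl mul1r {1}(psumS _ (leqnn (size h))) //.
rewrite (psumE _ (leqnSn (size h))) // mulr_sumr -big_split /=.
apply: ler_sum => i _; rewrite !expr1 mulrBl mul_polyC coefB coefZ mulrC -normrM.
exact: ler_normB.
Qed.

Lemma psum1_le_mahler (a : C) r :
  psum 1 (a *: \prod_(z <- r) ('X - z%:P))
    <= 2 ^+ size r * (`|a| * \prod_(z <- r) radius z).
Proof.
elim: r => [|z r IH].
  rewrite !big_nil mul1r mulr1 alg_polyC (@psumE 1 1) // ?size_polyC_leq1 //.
  by rewrite big_ord_recl big_ord0 coefC addr0.
rewrite !big_cons scalerAr exprS.
apply: le_trans (psum1_XsubC _ _) _.
rewrite (mulrCA `|a|) mulrACA; apply: ler_pM => //.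
- by rewrite addr_ge0.
- by rewrite sumr_ge0 // => i _; rewrite exprn_ge0.
by rewrite mulr_natl mulr2n lerD ?radius_ge1 ?radius_ge_norm.
Qed.

(** The 1-norm of u is at most 2 ^ deg u times its Mahler measure.  The Mahler
measure is multiplicative, that of q is at least its leading coefficient, and
that of the product is at most its Euclidean norm.  Keeping the leading
coefficient of q is what bounds the multiple (w' / lc d) d of the gcd. *)
Lemma mignotte u q :
  (`|lead_coef q| * psum 1 u) ^+ 2 <= 4 ^+ (size u).-1 * psum 2 (u * q).
Proof.
have [ru Du] := closed_field_poly_normal u.
have [rq Dq] := closed_field_poly_normal q.
have [->|nzu] := eqVneq u 0.
  by rewrite /psum mul0r size_poly0 !big_ord0 !mulr0 expr0n.
have Eu : (size u).-1 = size ru.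
  by rewrite {1}Du size_scale ?lead_coef_eq0 // size_prod_XsubC.
have -> : (4 : C) = 2 ^+ 2 by rewrite -natrX.
rewrite Eu -exprM mulnC exprM.
apply: (@le_trans _ _ ((2 ^+ size ru) ^+ 2 *
   (`|lead_coef (u * q)| * \prod_(z <- ru ++ rq) radius z) ^+ 2)).
  rewrite -exprMn lerXn2r ?nnegrE ?mulr_ge0 ?exprn_ge0 ?sumr_ge0 //.
  - by move=> i _; rewrite exprn_ge0.
  - exact: le_trans (prod_radius_ge1 _).
  rewrite lead_coefM normrM big_cat /=.
  have -> : forall x a b c d : C, x * (a * b * (c * d)) = b * (x * (a * c) * d).
    by move=> x a b c d; rewrite !mulrA -!(mulrC b) !mulrA.
  rewrite ler_wpM2l //.
  rewrite {1}Du; apply: le_trans (psum1_le_mahler _ _) _.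
  rewrite ler_peMr ?prod_radius_ge1 // !mulr_ge0 ?exprn_ge0 //.
  exact: le_trans (prod_radius_ge1 _).
rewrite ler_wpM2l ?exprn_ge0 //.
have {2}-> : u * q = (lead_coef (u * q))%:P * \prod_(z <- ru ++ rq) ('X - z%:P).
  by rewrite mul_polyC big_cat /= {1}Du {1}Dq -scalerAl -scalerAr scalerA lead_coefM.
by have := landau (ru ++ rq) (lead_coef (u * q))%:P; rewrite lead_coefC.
Qed.
End PowerSums.

(** * Norms of integer polynomials *)

(** The 1-norm for k = 1 and the squared Euclidean norm for k = 2, as natural
numbers. *)
Definition coefsum k (u : {poly int}) : nat := (\sum_(i < size u) `|(u`_i)%R| ^ k)%N.

Lemma psum_intr k (u : {poly int}) :
  psum k (map_poly intr u : {poly algC}) = (coefsum k u)%:R.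
Proof.
rewrite /psum /coefsum size_map_inj_poly //; last exact: intr_inj.
rewrite natr_sum; apply: eq_bigr => i _.
by rewrite coef_map /= natrX natr_absz intr_norm.
Qed.

Lemma mignotte_int (u q : {poly int}) :
  ((`|lead_coef q| * coefsum 1 u) ^ 2 <= 4 ^ deg u * coefsum 2 (u * q))%N.
Proof.
have := mignotte (map_poly intr u : {poly algC}) (map_poly intr q).
rewrite -rmorphM /= !psum_intr lead_coef_map_inj //; last exact: intr_inj.
rewrite size_map_inj_poly //; last exact: intr_inj.
by rewrite -intr_norm -natr_absz -natrM -!natrX -natrM ler_nat.
Qed.

Lemma coefsum_cauchy_schwarz (u : {poly int}) :
  (coefsum 1 u ^ 2 <= size u * coefsum 2 u)%N.
Proof.
rewrite /coefsum; set n := size u; set a := fun i : 'I_n => `|(u`_i)%R|%N.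
have -> : (\sum_(i < n) `|(u`_i)%R| ^ 1 = \sum_(i < n) a i)%N by apply: eq_bigr.
rewrite -[(n * _)%N]/(n * \sum_(i < n) a i ^ 2)%N.
rewrite -(leq_pmul2l (isT : 0 < 2)%N) -mulnn big_distrlr /= big_distrr /=.
have E : (\sum_(i < n) \sum_(j < n) (a i ^ 2 + a j ^ 2) =
         2 * (n * \sum_(i < n) a i ^ 2))%N.
  under eq_bigr do rewrite big_split /= sum_nat_const card_ord.
  by rewrite big_split /= -big_distrr /= sum_nat_const card_ord mul2n addnn.
rewrite -E; apply: leq_sum => i _; rewrite big_distrr /=.
by apply: leq_sum => j _; exact: nat_Cauchy.
Qed.

Lemma deg_mul (u v : {poly int}) :
  u != 0 -> v != 0 -> deg (u * v) = (deg u + deg v)%N.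
Proof.
by move=> u0 v0; rewrite /deg size_mul // (polySpred u0) (polySpred v0); lia.
Qed.

Lemma coefsum2_gt0 (u : {poly int}) : u != 0 -> (0 < coefsum 2 u)%N.
Proof.
move=> nz; rewrite /coefsum polySpred // big_ord_recr /=.
by rewrite ltn_addl // expn_gt0 absz_gt0 -lead_coefE lead_coef_eq0 nz.
Qed.

Lemma lead_coef_le_coefsum2 (u : {poly int}) :
  (`|lead_coef u| ^ 2 <= coefsum 2 u)%N.
Proof.
have [->|nz] := eqVneq u 0; first by rewrite lead_coef0.
by rewrite /coefsum polySpred // big_ord_recr /= leq_addl.
Qed.

Lemma coef_le_coefsum1 (u : {poly int}) i : (`|(u`_i)%R| <= coefsum 1 u)%N.
Proof.
have [le|lt] := leqP (size u) i; first by rewrite nth_default.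
by rewrite /coefsum (bigD1 (Ordinal lt)) //= leq_addr.
Qed.

Lemma coefsum2Z (c : int) (u : {poly int}) :
  c != 0 -> coefsum 2 (c *: u) = (`|c| ^ 2 * coefsum 2 u)%N.
Proof.
move=> nz; rewrite /coefsum size_scale // big_distrr /=.
by apply: eq_bigr => i _; rewrite coefZ abszM expnMn.
Qed.

(** * Bounds and values of resultants *)

(** Expanding the product over the rows gives one term for each map from rows to
columns; the Leibniz formula retains those given by permutations. *)
Lemma det_le_prod_row (R : numDomainType) n (A : 'M[R]_n) :
  `|\det A| <= \prod_i \sum_j `|A i j|.
Proof.
rewrite (bigA_distr_bigA (fun i j => `|A i j|)) /=.
apply: (@le_trans _ _ (\sum_(s : 'S_n) \prod_i `|A i (s i)|)).
  apply: le_trans (ler_norm_sum _ _ _) _; apply: ler_sum => s _.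
  by rewrite normrM normrX normrN1 expr1n mul1r normr_prod.
rewrite [leRHS](bigID (fun f : {ffun 'I_n -> 'I_n} => injectiveb f)) /=.
rewrite [X in _ <= X + _](reindex (@pval 'I_n)) /=; last first.
  have s0 : 'S_n := 1%g.
  by exists (insubd s0) => /= f Uf; first apply: val_inj; apply: insubdK.
rewrite -[leLHS]addr0 lerD //.
  rewrite le_eqVlt; apply/orP; left; apply/eqP.
  apply: eq_big => [s | s _]; first by rewrite (valP s).
  by apply: eq_bigr => i _; rewrite pvalE.
by apply: sumr_ge0 => f _; apply: prodr_ge0.
Qed.

Lemma coefsum1E (u : {poly int}) : (coefsum 1 u)%:Z = \sum_(i < size u) `|u`_i|.
Proof. by rewrite -natz natr_sum; apply: eq_bigr => i _; rewrite natz abszE. Qed.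

Lemma sum_coef_le (u : {poly int}) n : \sum_(j < n) `|u`_j| <= (coefsum 1 u)%:Z.
Proof.
rewrite coefsum1E.
have -> : \sum_(i < size u) `|u`_i| = \sum_(i < n + size u) `|u`_i|.
  rewrite addnC [RHS]big_split_ord /= [X in _ = _ + X]big1 ?addr0 // => i _.
  by rewrite nth_default ?normr0 // leq_addr.
by rewrite big_split_ord /= lerDl sumr_ge0.
Qed.

Lemma Sylvester_row_le (u : {poly int}) n k :
  \sum_(j < n) `|u`_(j - k) *+ (k <= j)%N| <= (coefsum 1 u)%:Z.
Proof.
elim: k n => [|k IH] n.
  under eq_bigr do rewrite subn0 mulr1n; exact: sum_coef_le.
case: n => [|n]; first by rewrite big_ord0.
by rewrite big_ord_recl mulr0n normr0 add0r; exact: IH.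
Qed.

Lemma resultant_le (f g : {poly int}) :
  (`|resultant f g| <= coefsum 1 f ^ deg g * coefsum 1 g ^ deg f)%N.
Proof.
rewrite -lez_nat abszE -[leRHS]natz natrM !natrX !natz.
apply: le_trans (det_le_prod_row _) _; rewrite big_split_ord /=.
rewrite -[in leRHS](card_ord (deg g)) -[in leRHS](card_ord (deg f)) -!prodr_const.
apply: ler_pM; do ?[by apply: prodr_ge0 => i _; exact: sumr_ge0].
  apply: ler_prod => i _; rewrite sumr_ge0 //=.
  under eq_bigr do rewrite Sylvester_mxE (unsplitK (inl _ i)).
  exact: Sylvester_row_le.
apply: ler_prod => i _; rewrite sumr_ge0 //=.
under eq_bigr do rewrite Sylvester_mxE (unsplitK (inr _ i)).
exact: Sylvester_row_le.
Qed.

(** With a constant argument the Sylvester matrix is scalar. *)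
Lemma resultant_constl (c : int) (g : {poly int}) :
  c != 0 -> resultant c%:P g = c ^+ deg g.
Proof.
move=> nz; have sc : (size c%:P).-1 = 0%N by rewrite size_polyC nz.
have none (k : 'I_(size c%:P).-1) : False by case: k => k; rewrite sc.
rewrite /resultant det_trig; last first.
  apply/is_trig_mxP => i j ltij; rewrite Sylvester_mxE.
  case: (split_ordP i) => [k Di|k]; last by case: (none k).
  have ltkj : (k < j)%N by move: ltij; rewrite Di.
  by rewrite coefC subn_eq0 leqNgt ltkj mul0rn.
rewrite big_split_ord /= [X in _ * X]big1 => [|k]; last by case: (none k).
rewrite mulr1 -[deg g]card_ord -prodr_const; apply: eq_bigr => i _.
by rewrite Sylvester_mxE (unsplitK (inl _ i)) coefC subnn leqnn.
Qed.

Lemma resultant_constr (c : int) (f : {poly int}) :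
  c != 0 -> resultant f c%:P = c ^+ deg f.
Proof.
move=> nz; have sc : (size c%:P).-1 = 0%N by rewrite size_polyC nz.
have none (k : 'I_(size c%:P).-1) : False by case: k => k; rewrite sc.
rewrite /resultant det_trig; last first.
  apply/is_trig_mxP => i j ltij; rewrite Sylvester_mxE.
  case: (split_ordP i) => [k|k Di]; first by case: (none k).
  have ltkj : (k < j)%N by move: ltij; rewrite Di /=; lia.
  by rewrite coefC subn_eq0 leqNgt ltkj mul0rn.
rewrite big_split_ord /= [X in X * _]big1 => [|k]; last by case: (none k).
rewrite mul1r -[deg f]card_ord -prodr_const; apply: eq_bigr => i _.
rewrite Sylvester_mxE (unsplitK (inr _ i)) coefC /=.
by rewrite sc add0n subnn leqnn.
Qed.

(** * The bound as a natural number *)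

Lemma norm2_sqr (R : rcfType) (u : {poly int}) :
  norm2 R u ^+ 2 = (coefsum 2 u)%:R.
Proof.
rewrite sqr_sqrtr; last by apply: sumr_ge0 => i _; rewrite sqr_ge0.
rewrite natr_sum; apply: eq_bigr => i _.
by rewrite natrX natr_absz intr_norm real_normK ?num_real.
Qed.

Lemma norm2_ge0 (R : rcfType) (u : {poly int}) : 0 <= norm2 R u.
Proof. exact: sqrtr_ge0. Qed.

(** Truncated subtraction is harmless in the exponent when both degrees are
positive; it would not be if exactly one of them were zero. *)
Definition Abound_sqr (f g : {poly int}) : nat :=
  let n := deg f in let m := deg g in
  (4 ^ (2 * n * m - n - m) * (n.+1 ^ m * m.+1 ^ n)
     * (coefsum 2 f ^ m * coefsum 2 g ^ n))%N.

Lemma AboundC (R : rcfType) (f g : {poly int}) : Abound R f g = Abound R g f.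
Proof.
rewrite /Abound mulnC -!mulrA [norm2 R f ^+ _ * _]mulrC.
by congr (2 ^ _ * _); lia.
Qed.

Lemma Abound_sqrE (R : rcfType) (f g : {poly int}) :
  (0 < deg f)%N -> (0 < deg g)%N -> Abound R f g ^+ 2 = (Abound_sqr f g)%:R.
Proof.
rewrite /Abound /Abound_sqr; move: (deg f) (deg g) => n m n0 m0.
have -> : (2 * n%:Z * m%:Z - n%:Z - m%:Z = (2 * n * m - n - m)%N)%R.
  by have : (n + m <= 2 * n * m)%N; [nia | lia].
rewrite -exprnP !exprMn sqr_sqrtr ?ler0n // ![in LHS](exprAC _ _ 2) !norm2_sqr.
by rewrite -[2 ^+ 2]natrX -!natrX -!natrM -mulnA.
Qed.

Lemma large_gt_double (R : rcfType) (f g : {poly int}) (p B : nat) :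
  2 * Abound R f g < p%:R -> (0 < deg f)%N -> (0 < deg g)%N ->
  (B ^ 2 <= Abound_sqr f g)%N -> (2 * B < p)%N.
Proof.
move=> lt_p f0 g0 leB; rewrite -(ltr_nat R) natrM; apply: le_lt_trans lt_p.
rewrite ler_pM2l ?ltr0n // -(@ler_pXn2r _ 2) ?nnegrE ?ler0n //; last first.
  by rewrite !mulr_ge0 ?exprz_ge0 ?sqrtr_ge0 ?exprn_ge0 ?norm2_ge0.
by rewrite Abound_sqrE // -natrX ler_nat.
Qed.

(** With c the constant and m = deg g, the bound is (|c| / 2) ^ m; if |c| >= p >= 2
this is at least |c| / 2, so twice the bound would reach p. *)
Lemma large_gt_constant (R : rcfType) (f g : {poly int}) (p : nat) :
  prime p -> 2 * Abound R f g < p%:R -> deg f = 0%N -> (0 < deg g)%N ->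
  (`|lead_coef f| < p)%N.
Proof.
move=> /prime_gt1 p_gt1 lt_p f0 g0; rewrite ltnNge; apply/negP => le_p.
move: lt_p; rewrite ltNge => /negP; apply; apply: (@le_trans _ _ `|lead_coef f|%N%:R).
  by rewrite ler_nat.
rewrite /Abound f0 /= expr0 exp1n expn0 muln1 sqrtr1 !mulr1 mulr0 mul0r subr0 sub0r.
have -> : norm2 R f = `|lead_coef f|%N%:R.
  apply/eqP; rewrite -(@eqrXn2 _ 2) ?norm2_ge0 ?ler0n // norm2_sqr -natrX.
  have [->|nz] := eqVneq f 0.
    by rewrite /coefsum lead_coef0 size_poly0 big_ord0.
  by rewrite /coefsum lead_coefE polySpred // -/(deg f) f0 big_ord_recl big_ord0 addn0.
set x := _%:R; have x2 : 2 <= x by rewrite ler_nat (leq_trans p_gt1).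
rewrite -exprnN -exprVn -exprMn; set y := _^-1 * x.
have Dx : x = 2 * y by rewrite mulVKf ?pnatr_eq0.
rewrite [leLHS]Dx ler_pM2l ?ltr0n // ler_eXnr //.
by rewrite -(@ler_pM2l _ 2) ?ltr0n // -Dx mulr1.
Qed.

Lemma ndvdz_small (p : nat) (x : int) :
  x != 0 -> (`|x| < p)%N -> ~~ (p%:Z %| x)%Z.
Proof.
by move=> nz lt; rewrite dvdzE gtnNdvd // absz_gt0.
Qed.

Lemma ndvdz_exp (p : nat) (c : int) m : prime p ->
  ((0 < m)%N -> c != 0 /\ (`|c| < p)%N) ->
  ~~ (p%:Z %| c ^+ m)%Z.
Proof.
move=> p_prime; case: m => [_|m /(_ isT)[c0 lt_c]].
  by rewrite dvdz1 gtn_eqF ?prime_gt1.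
by rewrite dvdzE abszX Euclid_dvdX // andbT gtnNdvd ?absz_gt0.
Qed.

Lemma leq_expn2r_mono a b m : (a <= b -> a ^ m <= b ^ m)%N.
Proof. by case: m => // m le; rewrite leq_exp2r. Qed.

(** Two different estimates, according to whether d is constant.  If it is, the
cofactors have the degrees n, m of the products and Cauchy-Schwarz suffices.  If
it is not, their degrees are at most n - 1 and m - 1, which leaves room in the
power of 4 for the losses of Mignotte's inequality. *)
Lemma resultant_sqr_le (d f1 g1 : {poly int}) :
  d != 0 -> f1 != 0 -> g1 != 0 ->
  (0 < deg (f1 * d))%N -> (0 < deg (g1 * d))%N ->
  (`|resultant f1 g1| ^ 2 <= Abound_sqr (f1 * d) (g1 * d))%N.
Proof.
move=> d0 f10 g10; set f := f1 * d; set g := g1 * d => degf degg.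
have Ef : deg f = (deg f1 + deg d)%N by rewrite deg_mul.
have Eg : deg g = (deg g1 + deg d)%N by rewrite deg_mul.
have Sf : (0 < coefsum 2 f)%N by rewrite coefsum2_gt0 ?mulf_neq0.
have Sg : (0 < coefsum 2 g)%N by rewrite coefsum2_gt0 ?mulf_neq0.
apply: (@leq_trans ((coefsum 1 f1 ^ 2) ^ deg g1 * (coefsum 1 g1 ^ 2) ^ deg f1)).
  by rewrite -!expnM ![(2 * _)%N]mulnC !expnM -expnMn leq_expn2r_mono ?resultant_le.
rewrite /Abound_sqr.
have [degd|degd] := posnP (deg d).
  have le u : (coefsum 1 u ^ 2 <= (deg (u * d)).+1 * coefsum 2 (u * d))%N.
    have /size_poly1P[c c0 ->] : size d == 1%N.
      by rewrite (polySpred d0) -/(deg d) degd.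
    have -> : u * c%:P = c *: u by rewrite mulrC mul_polyC.
    apply: leq_trans (coefsum_cauchy_schwarz u) _.
    rewrite coefsum2Z // /deg size_scale // leq_mul ?leqSpred //.
    by rewrite leq_pmull // expn_gt0 absz_gt0 c0.
  have [le_f le_g] := (le f1, le g1); rewrite degd !addn0 in Ef Eg.
  apply: (leq_trans (leq_mul (leq_expn2r_mono _ le_f) (leq_expn2r_mono _ le_g))).
  rewrite !expnMn mulnACA -/f -/g Ef Eg.
  by rewrite leq_mul2r leq_pmull ?orbT ?expn_gt0.
have le u : (coefsum 1 u ^ 2 <= 4 ^ deg u * coefsum 2 (u * d))%N.
  apply: leq_trans (mignotte_int u d); rewrite leq_expn2r_mono // leq_pmull //.
  by rewrite absz_gt0 lead_coef_eq0.
apply: (leq_trans (leq_mul (leq_expn2r_mono _ (le f1)) (leq_expn2r_mono _ (le g1)))).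
rewrite !expnMn mulnACA -!expnM -expnD -/f -/g.
apply: leq_mul; last by apply: leq_mul; rewrite leq_pexp2l ?Ef ?Eg ?leq_addr.
rewrite -[leqLHS]muln1 leq_mul ?muln_gt0 ?expn_gt0 //.
by rewrite leq_pexp2l // Ef Eg; nia.
Qed.

(** Mignotte's inequality for d costs a factor 4 ^ deg d, where deg d is at most
min (n, m).  The case n = m = 1 is separate because the power of 4 in the bound is then 1:
the missing factor 4 comes from (n + 1) ^ m (m + 1) ^ n. *)
Lemma candidate_sqr_le (d q f g : {poly int}) :
  d != 0 -> q != 0 -> f = q * d -> (deg d <= deg g)%N ->
  (0 < deg f)%N -> (0 < deg g)%N -> g != 0 ->
  ((`|lead_coef q| * coefsum 1 d) ^ 2 <= Abound_sqr f g)%N.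
Proof.
move=> d0 q0 Df le_dg degf degg g0.
have f0 : f != 0 by rewrite Df mulf_neq0.
have le_df : (deg d <= deg f)%N by rewrite Df deg_mul // leq_addl.
apply: leq_trans (mignotte_int d q) _; rewrite (mulrC d) -Df /Abound_sqr.
apply: leq_mul; last first.
  rewrite -[leqLHS]muln1 leq_mul ?expn_gt0 ?coefsum2_gt0 //.
  by rewrite -[leqLHS]expn1 leq_pexp2l ?coefsum2_gt0.
move: (deg f) (deg g) (deg d) degf degg le_df le_dg => n m k n0 m0 kn km.
have [/andP[/eqP n1 /eqP m1]|/nandP nm] := boolP ((n == 1) && (m == 1))%N.
  rewrite n1 m1 in kn *; by rewrite -[leqRHS]/(4 ^ 1)%N leq_pexp2l //; lia.
rewrite -[leqLHS]muln1 leq_mul ?muln_gt0 ?expn_gt0 // leq_pexp2l //.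
suff : (k + n + m <= 2 * n * m)%N by lia.
have [n2|m2] : (1 < n \/ 1 < m)%N by lia.
  by have := leq_mul n2 m0; nia.
by have := leq_mul n0 m2; nia.
Qed.

(** * Greatest common divisors over the integers *)

(** For non-zero f and g, the gcd of their primitive parts: primitive, with
positive leading coefficient. *)
Definition zgcdp (f g : {poly int}) : {poly int} := zprimitive (gcdp f g).

Lemma is_zgcdp_scale (f g : {poly int}) :
  f != 0 -> g != 0 -> is_zgcdp (gcd_cont f g *: zgcdp f g) f g.
Proof.
move=> f0 g0.
have dvd u : gcdp f g %| u -> (gcd_cont f g %| zcontents u)%Z ->
    zdvdp (gcd_cont f g *: zgcdp f g) u.
  move=> /dvdpP_int[r Du] /dvdzP[b Db]; exists (b *: zprimitive r).
  rewrite -scalerAr -scalerAl scalerA mulrC -Db mulrC [LHS]zpolyEprim.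
  by congr (_ *: _); rewrite {1}Du zprimitiveM zprimitive_id.
have [dvf dvg] : (gcd_cont f g %| zcontents f)%Z /\ (gcd_cont f g %| zcontents g)%Z.
  by apply/andP; rewrite -dvdz_gcd dvdzz.
split; [by apply: dvd; rewrite ?dvdp_gcdl | by apply: dvd; rewrite ?dvdp_gcdr |].
move=> c [qf Df] [qg Dg].
have /dvdpP_int[r Dr] : c %| gcdp f g by rewrite dvdp_gcd Df Dg !dvdp_mull.
have /dvdzP[b Db] : (zcontents c %| gcd_cont f g)%Z.
  by rewrite dvdz_gcd Df Dg !zcontentsM; apply/andP; split; exact: dvdz_mull (dvdzz _).
exists (b *: zprimitive r); rewrite /zgcdp Dr zprimitiveM zprimitive_id Db.
rewrite [c in RHS]zpolyEprim -scalerAr -scalerAl scalerA.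
by rewrite [zcontents c * b]mulrC [zprimitive r * _]mulrC.
Qed.

Lemma zgcdp_cofactors (f g : {poly int}) : f != 0 -> g != 0 ->
  exists2 f1g1 : {poly int} * {poly int},
    f = f1g1.1 * zgcdp f g /\ g = f1g1.2 * zgcdp f g
  & coprimep f1g1.1 f1g1.2.
Proof.
move=> f0 g0; have [rf Df] := dvdpP_int (dvdp_gcdl f g).
have [rg Dg] := dvdpP_int (dvdp_gcdr f g).
rewrite mulrC -/(zgcdp f g) in Df; rewrite mulrC -/(zgcdp f g) in Dg.
exists (rf, rg) => //=; set d := zgcdp f g in Df Dg.
have d0 : d != 0 by apply: contraNneq f0 => d0; rewrite Df d0 mulr0.
have := eqp_size (gcdp_mul2r rf rg d); rewrite -Df -Dg.
rewrite -[size (gcdp f g)]size_zprimitive -/d size_mul //; last first.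
  rewrite gcdp_eq0 negb_and; apply/orP; left.
  by apply: contraNneq f0 => r0; rewrite Df r0 mul0r.
rewrite (polySpred d0) addnS /= => /esym/eqP.
by rewrite -add1n eqn_add2r coprimep_def.
Qed.

(** If c is the primitive part of a common divisor of the cofactors, then c * d
divides d by maximality, so c is a unit. *)
Lemma is_zgcdp_coprime (d f1 g1 : {poly int}) :
  d != 0 -> f1 != 0 -> is_zgcdp d (f1 * d) (g1 * d) -> coprimep f1 g1.
Proof.
move=> d0 f10 [_ _ max_d]; set c := zprimitive (gcdp f1 g1).
have [rf Df] := dvdpP_int (dvdp_gcdl f1 g1).
have [rg Dg] := dvdpP_int (dvdp_gcdr f1 g1).
have [||q] := max_d (c * d).
- by exists rf; rewrite mulrA [rf * c]mulrC -Df.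
- by exists rg; rewrite mulrA [rg * c]mulrC -Dg.
rewrite mulrA -[LHS]mul1r => /(mulIf d0) E.
have : q * c \is a GRing.unit by rewrite -E unitr1.
rewrite unitrM => /andP[_]; rewrite poly_unitE => /andP[/eqP sc _].
by rewrite coprimep_def -size_zprimitive -/c sc.
Qed.

Lemma zprimitive_const (c : int) : c != 0 -> zprimitive c%:P = 1.
Proof.
by move=> c0; rewrite -[c%:P]mulr1 mul_polyC zprimitiveZ // zprimitive_monic ?monic1.
Qed.

Lemma zprimitive_deg0 (u : {poly int}) : u != 0 -> deg u = 0%N -> zprimitive u = 1.
Proof.
move=> u0 du; have /size_poly1P[c c0 ->] : size u == 1%N.
  by rewrite (polySpred u0) -/(deg u) du.
exact: zprimitive_const.
Qed.

(** * Reduction modulo p and centered lift *)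

Section ModularArithmetic.
Variable p : nat.
Hypothesis p_prime : prime p.

Lemma intr_Fp_eq0 (x : int) : ((x%:~R : 'F_p) == 0) = (p%:Z %| x)%Z.
Proof. by rewrite (dvdz_pcharf (pchar_Fp p_prime)). Qed.

Lemma ltn_Fp (b : 'F_p) : (b < p)%N.
Proof. by have := ltn_ord b; rewrite [X in (_ < X)%N]Fp_cast. Qed.

Lemma centered0 : centered (0 : 'F_p) = 0.
Proof. by rewrite /centered muln0 prime_gt0. Qed.

Lemma centered_eq0 (b : 'F_p) : (centered b == 0) = (b == 0).
Proof.
apply/eqP/eqP => [|->]; last exact: centered0.
rewrite /centered; have := ltn_Fp b => lt_b; case: ifP => _ E; last by lia.
by apply: val_inj => /=; lia.
Qed.

Lemma centered_intr (x : int) : (2 * `|x| < p)%N -> centered (x%:~R : 'F_p) = x.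
Proof.
case: (intP x) => [|n|n] lt_x; first by rewrite centered0.
  by rewrite /centered -[_%:~R]/(n.+1%:R) val_Fp_nat // modn_small ?lt_x //; lia.
have lt_n : (2 * n.+1 < p)%N by rewrite abszN in lt_x.
have -> : ((- n.+1%:Z)%:~R : 'F_p) = (p - n.+1)%:R.
  rewrite natrB; last by lia.
  by rewrite pchar_Fp_0 // sub0r rmorphN.
rewrite /centered val_Fp_nat // modn_small; last by lia.
by case: ifP => ?; lia.
Qed.

Lemma centered_lift_redp (u : {poly int}) :
  (forall i, 2 * `|(u`_i)%R| < p)%N -> centered_lift (redp p u) = u.
Proof.
move=> small; apply/polyP => i.
by rewrite coef_map_id0 ?centered0 // coef_map /= centered_intr.
Qed.

Lemma centered_lift_polyC (b : 'F_p) :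
  centered_lift b%:P = (centered b)%:P :> {poly int}.
Proof.
rewrite /centered_lift; apply/polyP => i.
by rewrite coef_map_id0 ?centered0 // !coefC; case: eqP; rewrite ?centered0.
Qed.

(** The resultant is a combination of f1 and g1 when both are non-constant, so its
reduction is a unit in the ideal of theirs.  The primitive parts matter when
f1 and g1 are constants: the resultant is then 1, although both may vanish
modulo p. *)
Lemma coprimep_redp (f1 g1 : {poly int}) :
  f1 != 0 -> g1 != 0 -> ~~ (p%:Z %| resultant f1 g1)%Z ->
  coprimep (redp p (zprimitive f1)) (redp p (zprimitive g1)).
Proof.
move=> f0 g0; rewrite -intr_Fp_eq0 => nz_res.
have [sf|sf] := leqP (size f1) 1.
  rewrite zprimitive_deg0 ?/deg //; last by lia.
  by rewrite /redp rmorph1 coprime1p.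
have [sg|sg] := leqP (size g1) 1.
  rewrite (zprimitive_deg0 g0) ?/deg //; last by lia.
  by rewrite /redp rmorph1 coprimep1.
have [[u v] /= _ E] := resultant_in_ideal sf sg.
have: coprimep (redp p f1) (redp p g1).
  apply/Bezout_coprimepP; exists (redp p u, redp p v) => /=.
  by rewrite /redp -!rmorphM -rmorphD /= -E map_polyC /= polyC_eqp1.
rewrite {1}[f1]zpolyEprim {1}[g1]zpolyEprim /redp -!mul_polyC !rmorphM /=.
by rewrite coprimepMl !coprimepMr => /andP[_ /andP[]].
Qed.

End ModularArithmetic.

Lemma dvdz_lead_zprimitive (a : int) (u : {poly int}) :
  (a %| lead_coef (zprimitive u))%Z -> (a %| lead_coef u)%Z.
Proof. by rewrite [u in X in _ -> X]zpolyEprim lead_coefZ; exact: dvdz_mull. Qed.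

(** * Primes above the bound *)

Section LargePrime.
Variables (R : rcfType) (f g : {poly int}) (p : nat).
Hypotheses (f_neq0 : f != 0) (g_neq0 : g != 0) (p_prime : prime p).
Hypothesis p_large : 2 * Abound R f g < p%:R.

Lemma large_ndvd_lead_coef :
  (0 < deg f + deg g)%N -> ~~ (p%:Z %| gcd_lc f g)%Z.
Proof.
move=> fg0; rewrite /gcd_lc dvdz_gcd negb_and.
have [f0|f0] := posnP (deg f).
  rewrite ndvdz_small ?lead_coef_eq0 // (large_gt_constant p_prime p_large) //.
  by rewrite f0 in fg0.
have [g0|g0] := posnP (deg g).
  rewrite (@ndvdz_small p (lead_coef g)) ?orbT ?lead_coef_eq0 //.
  by apply: (large_gt_constant p_prime _ g0 f0); rewrite AboundC; exact: p_large.
rewrite ndvdz_small ?lead_coef_eq0 //.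
apply: (@leq_ltn_trans (2 * `|lead_coef f|)); first by rewrite leq_pmull.
apply: (large_gt_double p_large) => //; apply: leq_trans (lead_coef_le_coefsum2 f) _.
rewrite /Abound_sqr.
have : (coefsum 2 f <= coefsum 2 f ^ deg g * coefsum 2 g ^ deg f)%N.
  rewrite -[leqLHS]muln1 leq_mul ?expn_gt0 ?coefsum2_gt0 //.
  by rewrite -[leqLHS]expn1 leq_pexp2l ?coefsum2_gt0.
by move=> /leq_trans; apply; rewrite leq_pmull // !muln_gt0 !expn_gt0.
Qed.

Lemma large_ndvd_resultant (d f1 g1 : {poly int}) :
  f = f1 * d -> g = g1 * d -> coprimep f1 g1 -> ~~ (p%:Z %| resultant f1 g1)%Z.
Proof.
move=> Df Dg co.
have [/andP[f10 d0] g10] : ((f1 != 0) && (d != 0)) /\ g1 != 0.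
  by move: f_neq0 g_neq0; rewrite Df Dg !mulf_eq0 !negb_or => -> /andP[].
have const_case (u v u1 v1 : {poly int}) : u1 != 0 -> v1 != 0 ->
    2 * Abound R u v < p%:R -> u = u1 * d -> v = v1 * d -> deg u = 0%N ->
    exists2 c : int, c != 0 /\ u1 = c%:P & ~~ (p%:Z %| c ^+ deg v1)%Z.
  move=> u10 v10 lt_p Du Dv degu.
  have /size_poly1P[c c0 Dc] : size u1 == 1%N.
    move/eqP: degu; rewrite Du deg_mul // addn_eq0 => /andP[/eqP degu1 _].
    by rewrite (polySpred u10) -/(deg u1) degu1.
  exists c => //; apply: ndvdz_exp => // v1_gt0; split => //.
  have := large_gt_constant p_prime lt_p degu.
  rewrite Dv deg_mul // addn_gt0 v1_gt0 => /(_ isT); apply: leq_ltn_trans.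
  by rewrite Du lead_coefM Dc lead_coefC abszM leq_pmulr // absz_gt0 lead_coef_eq0.
have [degf|degf] := posnP (deg f).
  have [c [c0 ->] ndvd] := const_case f g f1 g1 f10 g10 p_large Df Dg degf.
  by rewrite resultant_constl.
have [degg|degg] := posnP (deg g).
  have lt_p : 2 * Abound R g f < p%:R by rewrite AboundC.
  have [c [c0 ->] ndvd] := const_case g f g1 f1 g10 f10 lt_p Dg Df degg.
  by rewrite resultant_constr.
apply: ndvdz_small; first by rewrite resultant_eq0 -leqNgt (eqP co).
apply: (@leq_ltn_trans (2 * `|resultant f1 g1|)); first by rewrite leq_pmull.
apply: (large_gt_double p_large) => //.
by rewrite Df Dg resultant_sqr_le // -?Df -?Dg.
Qed.

Let F := zprimitive f.
Let G := zprimitive g.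
Let d := zgcdp f g.

Lemma large_ndvd_primitive_lead : ~~ (p%:Z %| gcd_lc F G)%Z.
Proof.
have [|fg0] := posnP (deg f + deg g).
  move=> /eqP; rewrite addn_eq0 => /andP[/eqP degf /eqP degg].
  rewrite /F /G !zprimitive_deg0 // /gcd_lc lead_coef1 gcd1z dvdz1.
  by rewrite gtn_eqF ?prime_gt1.
apply: contra (large_ndvd_lead_coef fg0).
rewrite /gcd_lc !dvdz_gcd => /andP[dvF dvG].
by apply/andP; split; exact: dvdz_lead_zprimitive.
Qed.

(** The factor h is w' / lc d, so that h *: d is the polynomial whose reduction is
the normalized modular gcd.  If d is constant its coefficients need not be small:
p may be 2, and then 1 lifts to -1. *)
Lemma scaled_gcd : exists h : int,
  [/\ gcd_lc F G = h * lead_coef d,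
      forall e : {poly 'F_p}, is_modular_gcd F G e -> e %= redp p d
    & (0 < deg d)%N -> forall i, (2 * `|((h *: d)`_i)%R| < p)%N].
Proof.
have [[f1 g1] /= [Df Dg] co] := zgcdp_cofactors f_neq0 g_neq0.
rewrite -/d in Df Dg.
have [f10 d0] : f1 != 0 /\ d != 0.
  by apply/andP; rewrite -negb_or -mulf_eq0 -Df.
have g10 : g1 != 0 by apply: contraNneq g_neq0 => g10; rewrite Dg g10 mul0r.
have DF : F = zprimitive f1 * d by rewrite /F Df zprimitiveM zprimitive_id.
have DG : G = zprimitive g1 * d by rewrite /G Dg zprimitiveM zprimitive_id.
have /dvdzP[h Dh] : (lead_coef d %| gcd_lc F G)%Z.
  by rewrite dvdz_gcd DF DG !lead_coefM; apply/andP; split; apply: dvdz_mull (dvdzz _).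
exists h; split=> // [e He | degd i].
  apply: (eqp_trans He); rewrite DF DG /redp !rmorphM /=.
  apply: eqp_trans (gcdp_mul2r _ _ _) _.
  have := coprimep_redp p_prime f10 g10 (large_ndvd_resultant Df Dg co).
  rewrite -gcdp_eqp1 => /(eqp_mulr (redp p d)); rewrite mul1r; exact: id.
have degf : (0 < deg f)%N by rewrite Df deg_mul // addn_gt0 degd orbT.
have degg : (0 < deg g)%N by rewrite Dg deg_mul // addn_gt0 degd orbT.
apply: (large_gt_double p_large) => //.
apply: leq_trans (candidate_sqr_le d0 f10 Df _ degf degg g_neq0); last first.
  by rewrite Dg deg_mul // leq_addl.
rewrite leq_expn2r_mono // coefZ abszM leq_mul ?coef_le_coefsum1 //.
rewrite dvdn_leq ?absz_gt0 ?lead_coef_eq0 //.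
have: (gcd_lc F G %| lead_coef F)%Z by rewrite dvdz_gcdl.
rewrite Dh DF lead_coefM dvdz_mul2r ?lead_coef_eq0 //.
by move/dvdz_lead_zprimitive; rewrite dvdzE.
Qed.

Lemma modular_gcd_size (e : {poly 'F_p}) : is_modular_gcd F G e -> size e = size d.
Proof.
have [h [Dh He _]] := scaled_gcd; move=> /He /eqp_size ->.
have := large_ndvd_primitive_lead; rewrite -(intr_Fp_eq0 p_prime) Dh intrM mulf_eq0.
by rewrite negb_or => /andP[_ nz]; rewrite size_map_poly_id0.
Qed.

(** The lift is h *: d when d is non-constant.  When d = 1 the lift is some non-zero
constant, whose primitive part is 1. *)
Lemma candidate_primitive (e : {poly 'F_p}) (k : {poly int}) :
  is_modular_gcd F G e -> is_candidate F G e k -> zprimitive k = d.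
Proof.
have [h [Dh He small]] := scaled_gcd; move=> gcd_e [t Dt ->].
have nz := large_ndvd_primitive_lead; rewrite -(intr_Fp_eq0 p_prime) in nz.
have t0 : t != 0 by apply: contraNneq nz => t0; rewrite -Dt t0 scale0r lead_coef0.
have [hp dp] : h%:~R != 0 :> 'F_p /\ (lead_coef d)%:~R != 0 :> 'F_p.
  by apply/andP; rewrite -negb_or -mulf_eq0 -intrM -Dh.
have h0 : h != 0 by apply: contraNneq hp => ->.
have E : t *: e = redp p (h *: d).
  have lcE : lead_coef (redp p (h *: d)) = lead_coef (t *: e).
    by rewrite Dt Dh lead_coef_map_eq lead_coefZ //= intrM mulf_neq0.
  have /eqp_eq : t *: e %= redp p (h *: d).
    apply: (eqp_trans (eqp_scale _ t0)); apply: (eqp_trans (He e gcd_e)).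
    by rewrite /redp map_polyZ eqp_sym eqp_scale.
  by rewrite lcE; apply: scalerI; rewrite Dt.
have zd : zprimitive d = d by rewrite /d zprimitive_id.
have [degd|degd] := posnP (deg d); last first.
  by rewrite E (centered_lift_redp p_prime (small degd)) zprimitiveZ.
have d0 : d != 0 by apply: contraNneq dp => ->; rewrite lead_coef0.
have d1 : d = 1 by rewrite -zd zprimitive_deg0.
rewrite E d1 /redp alg_polyC map_polyC /=.
rewrite (centered_lift_polyC p_prime).
by rewrite zprimitive_const // centered_eq0.
Qed.

Lemma zgcdp_dvd : zdvdp d F /\ zdvdp d G.
Proof.
have [[f1 g1] /= [Df Dg] _] := zgcdp_cofactors f_neq0 g_neq0.
split; [exists (zprimitive f1) | exists (zprimitive g1)].
  by rewrite /F {1}Df zprimitiveM zprimitive_id.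
by rewrite /G {1}Dg zprimitiveM zprimitive_id.
Qed.

Lemma deg_zgcdp_lt : (deg d < (minn (deg F) (deg G)).+1)%N.
Proof.
rewrite ltnS leq_min; have [[u Du] [v Dv]] := zgcdp_dvd.
have F0 : F != 0 by rewrite zprimitive_eq0.
have G0 : G != 0 by rewrite zprimitive_eq0.
have le (w q : {poly int}) : w != 0 -> w = q * d -> (deg d <= deg w)%N.
  move=> w0 Dw; have : (q != 0) && (d != 0) by rewrite -negb_or -mulf_eq0 -Dw.
  case/andP=> q0 d0.
  by rewrite Dw deg_mul // leq_addl.
by rewrite (le _ _ F0 Du) (le _ _ G0 Dv).
Qed.

End LargePrime.

Theorem mainTheorem6 (R : rcfType) (f g : {poly int}) (p : nat)
    (f_neq0 : f != 0) (g_neq0 : g != 0) (p_prime : prime p)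
    (p_large : 2 * Abound R f g < p%:R) :
  [/\ forall d f1 g1 : {poly int},
        is_zgcdp d f g -> f = f1 * d -> g = g1 * d ->
        ~~ (p%:Z %| resultant f1 g1)%Z,
      (0 < deg f + deg g)%N -> ~~ (p%:Z %| gcd_lc f g)%Z,
      exists s : bpm_state, bpm_step f g (bpm_start f g) p s
    & forall s : bpm_state, bpm_step f g (bpm_start f g) p s ->
        exists2 h : {poly int}, s = Halted [:: p] h & is_zgcdp h f g].
Proof.
have test e k : is_modular_gcd (zprimitive f) (zprimitive g) e ->
    is_candidate (zprimitive f) (zprimitive g) (e : {poly 'F_p}) k ->
    zprimitive k = zgcdp f g /\ div_test (zprimitive f) (zprimitive g) k.
  move=> gcd_e cand; rewrite /div_test.
  rewrite (candidate_primitive f_neq0 g_neq0 p_prime p_large gcd_e cand).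
  by split => //; exact: zgcdp_dvd.
have degP e : is_modular_gcd (zprimitive f) (zprimitive g) (e : {poly 'F_p}) ->
    (deg e < (minn (deg (zprimitive f)) (deg (zprimitive g))).+1)%N.
  move=> gcd_e; rewrite {1}/deg (modular_gcd_size f_neq0 g_neq0 p_prime p_large gcd_e).
  exact: deg_zgcdp_lt.
split=> [d f1 g1 gcd_d Df Dg | fg0 | | s].
- apply: (large_ndvd_resultant f_neq0 g_neq0 p_prime p_large Df Dg).
  have [f10 d0] : f1 != 0 /\ d != 0 by apply/andP; rewrite -negb_or -mulf_eq0 -Df.
  by apply: (is_zgcdp_coprime d0 f10); rewrite -Df -Dg.
- exact: large_ndvd_lead_coef f_neq0 g_neq0 p_prime p_large fg0.
- set F := zprimitive f; set G := zprimitive g.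
  pose e : {poly 'F_p} := gcdp (redp p F) (redp p G).
  have gcd_e : is_modular_gcd F G e by exact: eqpxx.
  have e0 : e != 0.
    rewrite -size_poly_gt0 (modular_gcd_size f_neq0 g_neq0 p_prime p_large gcd_e).
    by rewrite size_zprimitive size_poly_gt0 gcdp_eq0 negb_and f_neq0.
  pose t : 'F_p := (gcd_lc F G)%:~R / lead_coef e.
  have cand : is_candidate F G e (centered_lift (t *: e)).
    by exists t; rewrite // lead_coefZ divfK ?lead_coef_eq0.
  have [_ ok] := test _ _ gcd_e cand.
  by eexists; apply: BpmOutput gcd_e (degP _ gcd_e) cand ok.
rewrite /bpm_start; move Ds0: (Running _ _) => s0 step.
case: step Ds0 test degP => [ps D q e|ps D q e k|ps D q e k] _ _ gcd_e.
- by move=> le_De [_ DD] _ /(_ _ gcd_e); rewrite DD ltnNge le_De.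
- move=> _ cand _ [<- _] /(_ _ _ gcd_e cand)[-> _] _.
  by exists (gcd_cont f g *: zgcdp f g) => //; exact: is_zgcdp_scale.
by move=> _ cand fail_test _ /(_ _ _ gcd_e cand)[_ /fail_test].
Qed.
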